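(* Every $M$-embedded Banach space with a monotone Schauder basis has property A$^k$.
   Context: Banach spaces are over $\mathbb{R}$ or $\mathbb{C}$ (the same field for all spaces involved). A Banach space $X$ is $M$-embedded if $X^\perp\subset X^{***}$ (the annihilator in $X^{***}$ of $X$, viewed canonically inside $X^{**}$) is the kernel of an $L_1$-projection in $X^{***}$, i.e. $X^{***}=X^\perp\oplus Z$ for some subspace $Z$ with $\|x^\perp+z\|=\|x^\perp\|+\|z\|$ for every $x^\perp\in X^\perp$ and $z\in Z$. A Schauder basis is monotone if all its partial-sum projections have norm at most one. For Banach spaces $X,Z$, $K(X,Z)$ is the space of compact linear operators from $X$ into $Z$ with the operator norm, and $NA(X,Z)$ is the set of bounded linear operators $T:X\to Z$ attaining their norm, i.e. such that $\|T\|=\|Tx\|$ for some $x\in X$ with $\|x\|=1$. A Banach space $X$ has property A$^k$ if $K(X,Z)\cap NA(X,Z)$ is dense in $K(X,Z)$ for every Banach space $Z$. *)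

(* Defs.v *)
From HB Require Import structures.
From mathcomp Require Import all_boot all_order all_algebra.
From mathcomp Require Import complex.
From mathcomp Require Import all_classical all_reals all_analysis.

Set Implicit Arguments.
Unset Strict Implicit.
Unset Printing Implicit Defensive.

Import Order.TTheory GRing.Theory Num.Theory.
Import numFieldNormedType.Exports.
Local Open Scope classical_set_scope.
Local Open Scope ring_scope.

Variant scalar_kind := RealScalars | ComplexScalars.

Definition scalar_field (R : realType) (k : scalar_kind) : numFieldType :=
  match k with
  | RealScalars => R
  | ComplexScalars => R[i]
  end.

(* The norm of a [normedModType K] takes its values in [K].  When [K] is [R[i]]
   these values are real; [real_part] and [of_real] convert them to and from
   [R], where suprema are available. *)
Definition of_real (R : realType) (k : scalar_kind) : R -> scalar_field R k :=
  match k return R -> scalar_field R k with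
  | RealScalars => id
  | ComplexScalars => real_complex R
  end.

Definition real_part (R : realType) (k : scalar_kind) : scalar_field R k -> R :=
  match k return scalar_field R k -> R with
  | RealScalars => id
  | ComplexScalars => @complex.Re R
  end.

Arguments of_real {R k}.
Arguments real_part {R k}.

Section scalar_theory.
Context {R : realType} {k : scalar_kind}.
Local Notation K := (scalar_field R k).

Lemma of_realK : cancel (@of_real R k) real_part.
Proof. by case: k. Qed.

Lemma real_partK (z : K) : 0 <= z -> of_real (real_part z) = z.
Proof.
by case: k z => //= -[a b]; rewrite lecE /= => /andP[/eqP -> _].
Qed.

Lemma of_real0 : of_real 0 = 0 :> K. Proof. by case: k. Qed.

Lemma of_realD x y : of_real (x + y) = of_real x + of_real y :> K.
Proof. by case: k => //=; rewrite rmorphD. Qed.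

Lemma of_realM x y : of_real (x * y) = of_real x * of_real y :> K.
Proof. by case: k => //=; rewrite rmorphM. Qed.

Lemma ler_of_real x y : (of_real x <= of_real y :> K) = (x <= y).
Proof. by case: k => //=; rewrite lecR. Qed.

Lemma ler_real_part (x y : K) : x <= y -> real_part x <= real_part y.
Proof. by case: k x y => //= x y; rewrite lecE => /andP[]. Qed.

End scalar_theory.

Section bounded_operators.
Context {R : realType} {k : scalar_kind}.
Local Notation K := (scalar_field R k).

Section type.
Variables X Z : normedModType K.

Definition bounded_operator : {pred X -> Z} := [pred f : X -> Z |
  `[< linear f /\ exists M : K, forall x, `|f x| <= M * `|x| >]].

Lemma bounded_operator_submod_closed : submod_closed bounded_operator.
Proof.
split.
  apply/asboolP; split=> [a u v|]; first by rewrite /= scaler0 addr0.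
  by exists 0 => x; rewrite mul0r normr0.
move=> a f g /asboolP[lf [M fM]] /asboolP[lg [N gN]]; apply/asboolP; split.
  move=> b u v; rewrite /GRing.add /GRing.scale /=.
  change (a *: f (b *: u + v) + g (b *: u + v) =
    b *: (a *: f u + g u) + (a *: f v + g v)).
  rewrite lf lg !scalerDr !scalerA (mulrC a b) -!addrA; congr (_ + _).
  by rewrite addrCA.
exists (`|a| * M + N) => x.
change (`|a *: f x + g x| <= (`|a| * M + N) * `|x|).
rewrite (le_trans (ler_normD _ _))// mulrDl lerD// normrZ -mulrA.
by rewrite ler_wpM2l.
Qed.

HB.instance Definition _ :=
  GRing.isSubmodClosed.Build K (X -> Z) bounded_operator
    bounded_operator_submod_closed.

Record bop := Bop { bop_fun :> X -> Z ; _ : bop_fun \in bounded_operator }.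

HB.instance Definition _ := [isSub for bop_fun].
HB.instance Definition _ := [Choice of bop by <:].
HB.instance Definition _ := [SubChoice_isSubLmodule of bop by <:].

Lemma bop_linear (T : bop) : linear T.
Proof. by case: T => f /= /asboolP[]. Qed.

HB.instance Definition _ (T : bop) :=
  GRing.isLinear.Build K X Z *:%R T (bop_linear T).

Lemma bop_ext (S T : bop) : S =1 T -> S = T.
Proof. by move=> ST; apply: val_inj; apply/funext. Qed.

Definition opnorm (T : bop) : K :=
  of_real (sup [set real_part `|T x| | x in [set x : X | `|x| <= 1]]).

Lemma opnorm_has_sup (T : bop) :
  has_sup [set real_part `|T x| | x in [set x : X | `|x| <= 1]].
Proof.
split; first by exists (real_part `|T 0|), 0; rewrite //= normr0.
case: T => f /= /asboolP[_ [M fM]]; exists (real_part `|M|) => _ [x /= x1 <-].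
apply: ler_real_part; apply: le_trans (fM x) _.
have [x0|x0] := eqVneq `|x| 0; first by rewrite x0 mulr0.
have x_gt0 : 0 < `|x| by rewrite lt_def x0 /=.
have M0 : 0 <= M by have := le_trans (normr_ge0 _) (fM x); rewrite pmulr_lge0.
by rewrite ger0_norm// ler_piMr.
Qed.

Lemma le_opnorm (T : bop) x : `|T x| <= opnorm T * `|x|.
Proof.
have [->|x0] := eqVneq x 0; first by rewrite linear0 !normr0 mulr0.
have xgt0 : 0 < `|x| by rewrite normr_gt0.
rewrite -ler_pdivrMr// -[leLHS]real_partK ?divr_ge0// ler_of_real.
apply: (ub_le_sup (opnorm_has_sup T).2).
exists (`|x|^-1 *: x); first by rewrite /= normfZV.
by rewrite linearZ normrZ /= normfV normr_id mulrC.
Qed.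

Lemma opnorm_le (T : bop) (c : K) :
  0 <= c -> (forall x, `|T x| <= c * `|x|) -> opnorm T <= c.
Proof.
move=> c0 Tc; rewrite -[leRHS]real_partK// ler_of_real.
apply: ge_sup; first exact: (opnorm_has_sup T).1.
move=> _ [x /= x1 <-]; apply: ler_real_part.
by apply: le_trans (Tc x) _; rewrite ler_piMr.
Qed.

Lemma opnorm_ge0 (T : bop) : 0 <= opnorm T.
Proof.
rewrite -of_real0 ler_of_real; apply: (ub_le_sup (opnorm_has_sup T).2).
exists 0; rewrite /= ?normr0//= linear0 normr0.
by rewrite -of_real0 of_realK.
Qed.

Lemma opnormD (S T : bop) : opnorm (S + T) <= opnorm S + opnorm T.
Proof.
apply: opnorm_le => [|x]; first by rewrite addr_ge0 ?opnorm_ge0.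
apply: le_trans (ler_normD (S x) (T x)) _.
by rewrite mulrDl lerD ?le_opnorm.
Qed.

Lemma opnormZ_le (a : K) (T : bop) : opnorm (a *: T) <= `|a| * opnorm T.
Proof.
apply: opnorm_le => [|x]; first by rewrite mulr_ge0 ?opnorm_ge0.
by rewrite (normrZ a (T x)) -mulrA ler_wpM2l ?le_opnorm.
Qed.

Lemma opnormZ (a : K) (T : bop) : opnorm (a *: T) = `|a| * opnorm T.
Proof.
apply/eqP; rewrite eq_le opnormZ_le/=.
have [->|a0] := eqVneq a 0; first by rewrite normr0 mul0r opnorm_ge0.
have := opnormZ_le a^-1 (a *: T).
by rewrite scalerA mulVf// scale1r normfV -ler_pdivrMl ?invr_gt0 ?normr_gt0// invrK.
Qed.

Lemma opnorm0_eq0 (T : bop) : opnorm T = 0 -> T = 0.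
Proof.
move=> T0; apply: bop_ext => x; apply/eqP; rewrite -normr_le0.
by rewrite (le_trans (le_opnorm T x))// T0 mul0r.
Qed.

HB.instance Definition _ :=
  Lmodule_isNormed.Build K bop opnormD opnormZ opnorm0_eq0.

End type.

Arguments bounded_operator : clear implicits.

Definition compact_operators (X Z : normedModType K) : set (bop X Z) :=
  [set T : bop X Z | precompact (T @` [set x : X | `|x| <= 1])].

Definition norm_attaining (X Z : normedModType K) : set (bop X Z) :=
  [set T : bop X Z | exists2 x : X, `|x| = 1 & `|T| = `|T x|].

Arguments compact_operators : clear implicits.
Arguments norm_attaining : clear implicits.

Definition dual_space (X : normedModType K) : normedModType K := bop X K^o.

Lemma bidual_embedding_subproof (X : normedModType K) (x : X) :
  (fun f : dual_space X => f x : K^o) \in bounded_operator (dual_space X) K^o.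
Proof.
apply/asboolP; split=> [a f g //|]; exists `|x| => f.
by rewrite mulrC; exact: (le_opnorm f x).
Qed.

Definition bidual_embedding (X : normedModType K) (x : X) : dual_space (dual_space X) :=
  Bop (bidual_embedding_subproof x).

(* The annihilator in X*** of the canonical image of X in X**. *)
Definition annihilator (X : normedModType K) : set (dual_space (dual_space (dual_space X))) :=
  [set phi | forall x : X, phi (bidual_embedding x) = 0].

Arguments annihilator : clear implicits.

Definition L1_summand (V : normedModType K) (W : set V) : Prop :=
  exists Z : set V, [/\ submod_closed [in Z],
    forall v, exists w z, [/\ W w, Z z & v = w + z],
    W `&` Z = [set 0] &
    forall w z, W w -> Z z -> `|w + z| = `|w| + `|z|].

Definition m_embedded (X : normedModType K) : Prop :=
  L1_summand (annihilator X).

Definition expansion (X : normedModType K) (e : nat -> X) (x : X) :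
  set (nat -> K) := [set a | series (fun n => a n *: e n) @ \oo --> x].

Definition schauder_basis (X : normedModType K) (e : nat -> X) : Prop :=
  forall x, exists! a, expansion e x a.

Definition coordinates (X : normedModType K) (e : nat -> X) (x : X) :
  nat -> K := xget (fun=> 0) (expansion e x).

Definition partial_sum (X : normedModType K) (e : nat -> X) (n : nat) (x : X) :
  X := \sum_(i < n) coordinates e x i *: e i.

Definition monotone_basis (X : normedModType K) (e : nat -> X) : Prop :=
  schauder_basis e /\
  forall n, exists2 P : bop X X, P =1 partial_sum e n & `|P| <= 1.

Definition property_Ak (X : completeNormedModType K) : Prop :=
  forall Z : completeNormedModType K,
    compact_operators X Z `<=`
      closure (compact_operators X Z `&` norm_attaining X Z).

End bounded_operators.

Arguments bounded_operator {R k} X Z.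
Arguments compact_operators {R k} X Z.
Arguments norm_attaining {R k} X Z.
Arguments annihilator {R k} X.

(* Main.v *)
(** Let [P n] be the partial-sum projections of the basis. If [X] is M-embedded,
    each [f] in the dual of [X] has only one norm-preserving extension from [X]
    to the bidual, namely evaluation at [f]. A functional on the dual that kills
    all [f \o P n] therefore kills [f], so the functionals fixed by some [P n]
    are dense in the dual and [f \o P n] tends to [f] in norm: the basis is
    shrinking. For compact [T] a cluster-point argument then yields
    [T \o P n --> T] in norm. Since [P n] is a contractive projection of finite
    rank, it maps the closed unit ball onto a compact subset of that ball, on
    which [norm (T u)] attains its maximum. *)

From HB Require Import structures.
Require Import Defs.
From mathcomp Require Import all_boot all_order all_algebra.
From mathcomp Require Import complex.
From mathcomp Require Import all_classical all_reals all_analysis.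
From mathcomp Require Import ring.

Set Implicit Arguments.
Unset Strict Implicit.
Unset Printing Implicit Defensive.

Import Order.TTheory GRing.Theory Num.Theory.
Import numFieldNormedType.Exports.
Local Open Scope classical_set_scope.
Local Open Scope ring_scope.

(** * Hahn-Banach for a sublinear functional on a real vector space *)

Section real_hahn_banach.
Variables (R : realType) (V : lmodType R) (p : V -> R).
Hypothesis pD : forall u v, p (u + v) <= p u + p v.
Hypothesis pZ : forall (t : R) v, 0 <= t -> p (t *: v) = t * p v.

(** Partial linear functionals are encoded as graphs, so that extension is inclusion and a chain has
    its union as upper bound. *)
Definition dominated_graph (G : set (V * R^o)) :=
  [/\ G 0, forall a x y, G x -> G y -> G (a *: x + y) &
    forall x, G x -> x.2 <= p x.1].

(** Subtracting the two points gives [(0, r - s)] in the graph, and [p 0 = 0]. *)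
Lemma dominated_graph_functional (G : set (V * R^o)) (v : V) (r s : R) :
  dominated_graph G -> G (v, r) -> G (v, s) -> r = s.
Proof.
move=> [_ Glin Gp]; suff main x y : G (v, x) -> G (v, y) -> x <= y.
  by move=> Gr Gs; apply/eqP; rewrite eq_le !main.
move=> Gx Gy; have := Gp _ (Glin (-1) _ _ Gy Gx).
have -> /= : (-1) *: (v, y : R^o) + (v, x) = (0, x - y).
  congr pair => /=; first by rewrite scaleN1r addNr.
  by rewrite scaleN1r addrC.
by rewrite -(scale0r 0) pZ// mul0r subr_le0.
Qed.

(* The slope [c] at [v0] must satisfy [r - p (v - v0) <= c <= p (v' + v0) - r']
   for all [(v, r)] and [(v', r')] in [G]. *)
Lemma dominated_graph_extend (G : set (V * R^o)) (v0 : V) :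
  dominated_graph G ->
  exists2 H, dominated_graph H & G `<=` H /\ exists c, H (v0, c).
Proof.
move=> [G0 Glin Gp].
pose S := [set x.2 - p (x.1 - v0) | x in G].
(* For [x] and [y] in [G], [x.2 + y.2 <= p (x.1 + y.1) <= p (x.1 - v0) + p (y.1 + v0)]. *)
have Sub y : G y -> ubound S (p (y.1 + v0) - y.2).
  move=> Gy _ [x Gx <-]; rewrite lerBrDr -addrAC lerBlDr.
  have := Gp _ (Glin 1 _ _ Gx Gy); rewrite scale1r => /le_trans; apply.
  rewrite addrC; apply: le_trans (pD _ _); rewrite /=.
  by rewrite addrACA subrr addr0.
have S0 : S !=set0 by exists ((0 : R) - p (0 - v0)), 0.
have supS : has_sup S by split => //; exists (p (0 + v0) - 0); exact: Sub 0 G0.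
pose c := sup S.
have cge x : G x -> x.2 - c <= p (x.1 - v0).
  move=> Gx; rewrite lerBlDr addrC -lerBlDr.
  by apply: (ub_le_sup supS.2); exists x.
have cle x : G x -> x.2 + c <= p (x.1 + v0).
  by move=> Gx; rewrite addrC -lerBrDr; apply: ge_sup => //; exact: Sub.
have GZ a x : G x -> G (a *: x).
  by move=> Gx; rewrite -[_ *: _]addr0; exact: Glin.
exists [set y | exists x t, G x /\ y = x + t *: (v0, c : R^o)].
- split.
  + by exists 0, 0; split => //; rewrite scale0r addr0.
  + move=> a _ _ [x [s [Gx ->]]] [y [t [Gy ->]]].
    exists (a *: x + y), (a * s + t); split; first exact: Glin.
    by rewrite scalerDr scalerDl scalerA addrACA.
  + move=> _ [x [t [Gx ->]]]; rewrite /=.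
    (* Positive homogeneity reduces the bound to [t = 1] or [t = -1], which are [cle] and [cge]. *)
    have [t0|t0|->] := ltgtP t 0; last first.
    * by rewrite !scale0r !addr0; exact: Gp.
    * have := cle _ (GZ t^-1 _ Gx); rewrite -(ler_pM2l t0) -(pZ _ (ltW t0)).
      by rewrite scalerDr mulrDr /= scalerA mulfV ?gt_eqF// scale1r mulrA
        mulfV ?gt_eqF// mul1r.
    * have t0' : 0 < - t by rewrite oppr_gt0.
      have := cge _ (GZ (- t)^-1 _ Gx).
      rewrite -(ler_pM2l t0') -(pZ _ (ltW t0')) scalerBr mulrBr /= scalerA.
      rewrite mulfV ?gt_eqF// scale1r mulrA.
      by rewrite mulfV ?gt_eqF// mul1r scaleNr mulNr !opprK.
- split=> [x Gx|]; first by exists x, 0; split => //; rewrite scale0r addr0.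
  by exists c, 0, 1; split => //; rewrite scale1r add0r.
Qed.

Lemma real_hahn_banach (G : set (V * R^o)) : dominated_graph G ->
  exists F : V -> R^o, [/\ linear F, forall v, F v <= p v &
    forall v r, G (v, r) -> F v = r].
Proof.
move=> Gdom; pose P A := dominated_graph (A `|` G).
have [|A [Adom Amax]] := @Zorn_bigcup _ P.
  move=> C CP Ctot; have [[X0 CX0]|C0] := pselect (C !=set0); last first.
    rewrite /P (_ : \bigcup_(X in C) X = set0) ?set0U//.
    by rewrite bigcup0// => X CX; exfalso; apply: C0; exists X.
  have sub X : C X -> X `|` G `<=` \bigcup_(X in C) X `|` G.
    by move=> CX x [Xx|]; [left; exists X|right].
  have in1 x : (\bigcup_(X in C) X `|` G) x -> exists2 X, C X & (X `|` G) x.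
    by case=> [[X CX Xx]|Gx]; [exists X => //; left|exists X0 => //; right].
  split.
  - by right; case: Gdom.
  - move=> a x y /in1[X CX Xx] /in1[Y CY Yy].
    wlog : X Y CX CY Xx Yy / X `<=` Y.
      move=> wl; have [XY|YX] := Ctot _ _ CX CY; first exact: (wl X Y).
      by apply: (wl X X) => //; case: Yy => [/YX|]; [left|right].
    move=> XY; apply: (sub Y CY); case: (CP _ CY) => _ Ylin _.
    by apply: Ylin => //; case: Xx => [/XY|]; [left|right].
  - by move=> x /in1[X CX Xx]; case: (CP _ CX) => _ _; apply.
(* Were no value assigned to [v], the one-step extension at [v] would contradict maximality of
   [A]. *)
have Atot v : exists c, (A `|` G) (v, c).
  have [H Hdom [AH [c Hc]]] := dominated_graph_extend v Adom.
  have [//|nAv] := pselect (exists c, (A `|` G) (v, c)).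
  exfalso; apply: (Amax H); last first.
    rewrite /P (_ : H `|` G = H)//; apply/setUidl => x Gx.
    by apply: AH; right.
  split=> [x Ax|HA]; first by apply: AH; left.
  by apply: nAv; exists c; left; exact: HA.
have [F FA] := choice Atot.
have FE v r : (A `|` G) (v, r) -> F v = r.
  by move=> Av; exact: dominated_graph_functional (FA v) Av.
exists F; split=> [a u v|v|v r Gv].
- by apply: FE; case: Adom => _ Alin _; exact: Alin a _ _ (FA u) (FA v).
- by case: Adom => _ _ /(_ _ (FA v)).
- by apply: FE; right.
Qed.

End real_hahn_banach.

(** * Norm-preserving extension and separation over real or complex scalars *)

Section norm_hahn_banach.
Variable R : realType.

Definition normed_graph (K : numFieldType) (V : normedModType K) (c : K)
    (G : set (V * K^o)) :=
  [/\ G 0, forall a x y, G x -> G y -> G (a *: x + y) &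
    forall x, G x -> `|x.2| <= c * `|x.1|].

Definition norm_extension (K : numFieldType) (V : normedModType K) (c : K)
    (G : set (V * K^o)) :=
  exists F : V -> K^o, [/\ linear F, forall v, `|F v| <= c * `|v| &
    forall v z, G (v, z) -> F v = z].

Lemma norm_hahn_banach_real (V : normedModType R) (c : R) (G : set (V * R^o)) :
  0 <= c -> normed_graph c G -> norm_extension c G.
Proof.
move=> c0 [G0 Glin Gc]; pose p (v : V) := c * `|v|.
have pD u v : p (u + v) <= p u + p v.
  by rewrite /p -mulrDr ler_wpM2l// ler_normD.
have pZ (t : R) v : 0 <= t -> p (t *: v) = t * p v.
  by move=> t0; rewrite /p normrZ ger0_norm// mulrCA.
have [|F [Flin Fp FG]] := @real_hahn_banach R V p pD pZ G.
  by split=> // x Gx; rewrite (le_trans (ler_norm _))// Gc.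
exists F; split=> // v; rewrite ler_norml Fp andbT lerNl.
have FZ a u : F (a *: u) = a * F u by exact: (GRing.scalable_linear Flin).
rewrite -mulN1r -FZ scaleN1r.
by rewrite -[leRHS](_ : p (- v) = _) ?Fp// /p normrN.
Qed.

(** An alias, so that the same additive group can carry a real module structure next to the complex
    one. *)
Definition realification (V : lmodType R[i]) : Type := V.

HB.instance Definition _ (V : lmodType R[i]) :=
  GRing.Zmodule.on (realification V).

Section realification_lmodule.
Variable V : lmodType R[i].

Definition real_scale (t : R) (v : realification V) : realification V :=
  (t%:C)%C *: (v : V).

Lemma real_scaleA a b v : real_scale a (real_scale b v) = real_scale (a * b) v.
Proof. by rewrite /real_scale scalerA rmorphM. Qed.

Lemma real_scale1 : left_id 1 real_scale.
Proof. by move=> v; rewrite /real_scale scale1r. Qed.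

Lemma real_scaleDr : right_distributive real_scale +%R.
Proof. by move=> a u v; rewrite /real_scale scalerDr. Qed.

Lemma real_scaleDl v : {morph real_scale^~ v : a b / a + b}.
Proof. by move=> a b; rewrite /real_scale rmorphD scalerDl. Qed.

HB.instance Definition _ := GRing.Zmodule_isLmodule.Build R (realification V)
  real_scaleA real_scale1 real_scaleDr real_scaleDl.

End realification_lmodule.

(** The real parts of the values extend to a real-linear [F]; the complex functional is recovered as
    [F v - i F (i v)]. *)
Lemma norm_hahn_banach_complex (V : normedModType R[i]) (c : R[i])
    (G : set (V * R[i]^o)) :
  0 <= c -> normed_graph c G -> norm_extension c G.
Proof.
move=> c0 [G0 Glin Gc].
pose p (v : realification V) : R := complex.Re (c * `|v : V|).
have pE v : c * `|v| = ((p v)%:C)%C.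
  have : 0 <= c * `|v| by rewrite mulr_ge0.
  by rewrite /p; case: (c * _) => a b; rewrite lecE /= => /andP[/eqP -> _].
have pD u v : p (u + v) <= p u + p v.
  by rewrite -lecR rmorphD /= -!pE -mulrDr ler_wpM2l// ler_normD.
have pZ (t : R) v : 0 <= t -> p (t *: v) = t * p v.
  move=> t0; apply: (@complexI R); rewrite rmorphM -!pE.
  rewrite [`|_|](normrZ (t%:C)%C (v : V)) mulrCA pE; congr (_ * _).
  by rewrite ger0_norm// lecR.
pose GR := [set (x.1 : realification V, complex.Re x.2 : R^o) | x in G].
have [|F [Flin Fp FG]] := @real_hahn_banach R _ p pD pZ GR.
  split.
  - by exists 0.
  - move=> a _ _ [x Gx <-] [y Gy <-].
    exists ((a%:C)%C *: x + y); first exact: Glin.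
    congr pair; rewrite /=.
    by case: (x.2) (y.2) => [x1 x2] [y1 y2]; rewrite /= mul0r subr0.
  - move=> _ [x Gx <-] /=; rewrite -lecR -pE; apply: le_trans (Gc x Gx).
    by rewrite (le_trans _ (normc_ge_Re _))// lecR ler_norm.
have FD := GRing.zmod_morphism_linear Flin.
have FZ (a : R) (u : realification V) : F (a *: u) = a * F u.
  exact: (GRing.scalable_linear Flin).
pose H (v : V) : R[i]^o := (F v +i* - F ('i%C *: v))%C.
have HD : zmod_morphism H.
  move=> u v; rewrite /H scalerBr !FD.
  by apply/eqP; rewrite eq_complex /= eqxx opprD /=.
have E (b : R[i]) (w : V) :
    F (b *: w) = complex.Re b * F w + complex.Im b * F ('i%C *: w).
  rewrite -!FZ [in LHS](complexE b) scalerDl -scalerA.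
  rewrite [X in F (_ + X)]scalerA mulrC -scalerA.
  by rewrite -[X in _ + X]opprK FD -mulN1r -FZ scaleN1r opprK.
have HZ a v : H (a *: v) = a * H v.
  rewrite /H scalerA (E a) (E ('i%C * a)).
  case: a => a b; apply/eqP; rewrite eq_complex /=.
  by apply/andP; split; apply/eqP; ring.
have Hlin : linear H.
  move=> a u v; rewrite -[v in LHS]opprK HD HZ -(scaleN1r v) HZ.
  by rewrite mulN1r opprK.
exists H; split=> // [v|v z Gv].
- have [->|Hv0] := eqVneq (H v) 0; first by rewrite normr0 mulr_ge0.
  (* Rotating [v] by the unit scalar [w] makes [H (w *: v)] real, hence equal
     to its real part [F (w *: v)]. *)
  pose w := `|H v| / H v.
  have Hw : H (w *: v) = `|H v| by rewrite HZ divfK.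
  have w1 : `|w| = 1 by rewrite normrM normr_id normfV divff// normr_eq0.
  have -> : `|H v| = ((F (w *: v))%:C)%C.
    rewrite -[F _]/(complex.Re (H (w *: v))) Hw.
    by rewrite RRe_real ?normr_real.
  rewrite (le_trans (_ : _ <= ((p (w *: v))%:C)%C))//; first by rewrite lecR.
  by rewrite -pE normrZ w1 mul1r.
- have FRe u y : G (u, y) -> F u = complex.Re y.
    by move=> Gu; apply: FG; exists (u, y).
  (* [G] is stable under multiplication by [i], and the real part of [i z] is minus the imaginary
     part of [z]. *)
  rewrite /H (FRe _ _ Gv) (FRe _ ('i%C * z)); last first.
    by have := Glin 'i%C _ _ Gv G0; rewrite addr0.
  by case: z {Gv} => x y; rewrite /= !mul0r mul1r sub0r opprK.
Qed.

Variable k : scalar_kind.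
Local Notation K := (scalar_field R k).

Theorem norm_hahn_banach (V : normedModType K) (c : K) (G : set (V * K^o)) :
  0 <= c -> normed_graph c G ->
  exists2 F : dual_space V, `|F| <= c & forall v z, G (v, z) -> F v = z.
Proof.
move=> c0 Gc; have [F [Flin Fc FG]] : norm_extension c G.
  case: k V c G c0 Gc => V c G.
    exact: norm_hahn_banach_real.
  exact: norm_hahn_banach_complex.
have Fb : F \in bounded_operator V K^o by apply/asboolP; split => //; exists c.
by exists (Bop Fb) => //; exact: opnorm_le.
Qed.

(** The functional [m + t x |-> t] is bounded by [d^-1]: for nonzero [t], the norm of [m + t x] is
    that of [t] times the distance from [x] to [- t^-1 m], a point of [M]. *)
Lemma separating_functional (V : normedModType K) (M : set V) (x : V) (d : K) :
  M 0 -> (forall a u v, M u -> M v -> M (a *: u + v)) ->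
  0 < d -> (forall m, M m -> d <= `|x - m|) ->
  exists F : dual_space V, F x = 1 /\ forall m, M m -> F m = 0.
Proof.
move=> M0 Mlin d0 xM.
pose G := [set (m.1 + m.2 *: x, m.2 : K^o) | m in [set m : V * K^o | M m.1]].
have [||F _ FG] := @norm_hahn_banach V d^-1 G.
- by rewrite invr_ge0 ltW.
- split.
  + by exists 0 => //; rewrite /= scale0r addr0.
  + move=> a _ _ [[u s] /= Mu <-] [[v t] /= Mv <-].
    exists (a *: u + v, a * s + t); first exact: Mlin.
    congr pair => //=.
    by rewrite scalerDr scalerA scalerDl addrACA.
  + move=> _ [[m t] /= Mm <-]; rewrite ler_pdivlMl//.
    have [->|t0] := eqVneq t 0; first by rewrite normr0 mulr0.
    have -> : m + t *: x = t *: (x - (- t^-1) *: m).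
      by rewrite scalerBr scalerA mulrN mulfV// scaleN1r opprK addrC.
    rewrite normrZ mulrC ler_wpM2l// xM// -[_ *: m]addr0.
    exact: Mlin.
exists F; split=> [|m Mm].
  by apply: FG; exists (0, 1); rewrite //= scale1r add0r.
by apply: FG; exists (m, 0); rewrite //= scale0r addr0.
Qed.

Lemma dual_separates (V : normedModType K) (x : V) :
  x != 0 -> exists F : dual_space V, F x = 1.
Proof.
move=> x0; have [||||F [Fx _]] := @separating_functional V [set 0] x `|x|.
- by [].
- by move=> a u v /= -> ->; rewrite scaler0 addr0.
- by rewrite normr_gt0.
- by move=> m /= ->; rewrite subr0.
- by exists F.
Qed.

End norm_hahn_banach.

(** * Bounded operators and unique extensions in M-embedded spaces *)

Section bounded_operator_facts.
Variables (R : realType) (k : scalar_kind).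
Local Notation K := (scalar_field R k).

Lemma le_bop (X Y : normedModType K) (T : bop X Y) x : `|T x| <= `|T| * `|x|.
Proof. exact: le_opnorm. Qed.

Lemma bop_comp_subproof (X Y Z : normedModType K) (T : bop Y Z) (S : bop X Y) :
  T \o S \in bounded_operator X Z.
Proof.
apply/asboolP; split=> [a u v|]; first by rewrite /= !linearP.
exists (`|T| * `|S|) => x /=; apply: le_trans (le_bop _ _) _.
by rewrite -mulrA ler_wpM2l// le_bop.
Qed.

Definition bop_comp (X Y Z : normedModType K) (T : bop Y Z) (S : bop X Y) :=
  Bop (bop_comp_subproof T S).

Lemma bop_comp_norm (X Y Z : normedModType K) (T : bop Y Z) (S : bop X Y) :
  `|bop_comp T S| <= `|T| * `|S|.
Proof.
apply: opnorm_le => [|x]; first by rewrite mulr_ge0.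
by rewrite -mulrA (le_trans (le_bop T _))// ler_wpM2l// le_bop.
Qed.

Lemma bop_continuous (X Y : normedModType K) (T : bop X Y) : continuous T.
Proof.
move=> x; apply/cvgrPdist_lt => e e0.
near=> y; rewrite -linearB (le_lt_trans (le_bop _ _))//.
have T0 : 0 < `|T| + 1 by rewrite ltr_wpDl.
rewrite (@le_lt_trans _ _ ((`|T| + 1) * `|x - y|))//.
  by rewrite ler_wpM2r// lerDl.
rewrite -ltr_pdivlMl//; near: y.
by apply: cvgr_dist_lt; [exact: cvg_id|rewrite mulr_gt0// invr_gt0].
Unshelve. all: by end_near. Qed.

Lemma bidual_embedding_norm (X : normedModType K) (x : X) :
  `|bidual_embedding x| <= `|x|.
Proof. by apply: opnorm_le => // f; rewrite mulrC; exact: (le_opnorm f x). Qed.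

(* Both [psi] and the canonical image of [f] lie in the complement of the
   annihilator, since [norm w + norm z = norm f <= norm z] forces [w = 0]. *)
Lemma m_embedded_extension (X : normedModType K) (f : dual_space X)
    (psi : dual_space (dual_space (dual_space X))) :
  m_embedded X -> `|psi| <= `|f| ->
  (forall x, psi (bidual_embedding x) = f x) -> psi = bidual_embedding f.
Proof.
move=> [Z [Zlin dec WZ0 normWZ]] psif psiE.
have inZ (phi : dual_space (dual_space (dual_space X))) :
    `|phi| <= `|f| -> (forall x, phi (bidual_embedding x) = f x) ->
    Z phi.
  move=> phif phiE; have [w [z [Ww Zz phiwz]]] := dec phi.
  (* On the canonical image of [X] the component [w] vanishes, so [z] acts there as [f]. *)
  have fz : `|f| <= `|z|.
    apply: opnorm_le => // x; rewrite -phiE phiwz.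
    change (`|w (bidual_embedding x) + z (bidual_embedding x)| <= `|z| * `|x|).
    rewrite Ww add0r (le_trans (le_bop _ _))// ler_wpM2l//.
    exact: bidual_embedding_norm.
  suff w0 : w = 0 by rewrite phiwz w0 add0r.
  apply/eqP; rewrite -normr_le0 -(lerD2r `|z|) add0r -(normWZ _ _ Ww Zz).
  by rewrite -phiwz (le_trans phif).
have Zpsi := inZ _ psif psiE.
have Zf : Z (bidual_embedding f).
  by apply: inZ => //; exact: bidual_embedding_norm.
apply/eqP; rewrite -subr_eq0; apply/eqP.
suff : (annihilator X `&` Z) (psi - bidual_embedding f) by rewrite WZ0.
split.
  move=> x; change (psi (bidual_embedding x) - f x = 0).
  by rewrite psiE subrr.
rewrite addrC -scaleN1r; apply: set_mem.
by apply: Zlin.2; exact: mem_set.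
Qed.

End bounded_operator_facts.

(** * Monotone bases and the shrinking property *)

Section monotone_basis.
Variables (R : realType) (k : scalar_kind).
Local Notation K := (scalar_field R k).
Variables (X : normedModType K) (e : nat -> X) (P : nat -> bop X X).
Hypothesis basis_e : schauder_basis e.
Hypothesis PE : forall n, P n =1 partial_sum e n.
Hypothesis P1 : forall n, `|P n| <= 1.

Lemma coordinates_expansion x : expansion e x (coordinates e x).
Proof. by apply: xgetPex; have [a [ax _]] := basis_e x; exists a. Qed.

Lemma coordinates_unique x a : expansion e x a -> coordinates e x = a.
Proof.
have [b [bx bu]] := basis_e x.
by move=> /bu <-; rewrite (bu _ (@coordinates_expansion x)).
Qed.

Lemma partial_sum_cvg x : P n x @[n --> \oo] --> x.
Proof.
have := @coordinates_expansion x; rewrite /expansion /=.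
suff -> : (fun n => P n x) = series (fun n => coordinates e x n *: e n) by [].
by apply/funext => n; rewrite PE /series /= big_mkord.
Qed.

(** The sequence padded with zeros has partial sums constant from [n] on, so it is the unique
    expansion. *)
Lemma coordinates_finite n (a : nat -> K) :
  coordinates e (\sum_(i < n) a i *: e i) =
  fun i => if (i < n)%N then a i else 0.
Proof.
apply: coordinates_unique; apply: cvg_near_cst.
exists n => // m /= nm; rewrite /series /= (big_cat_nat _ nm)//= big_mkord.
rewrite [X in _ + X]big_nat_cond [X in _ + X]big1 ?addr0.
  by apply: eq_bigr => i _; rewrite ltn_ord.
by move=> i /andP[/andP[ni _] _]; rewrite ltnNge ni scale0r.
Qed.

Lemma partial_sumM m n x : (m <= n)%N -> P m (P n x) = P m x.
Proof.
move=> mn; rewrite !PE /partial_sum coordinates_finite.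
by apply: eq_bigr => i _; rewrite (leq_trans (ltn_ord i)).
Qed.

Lemma partial_sumMr m n x : (m <= n)%N -> P n (P m x) = P m x.
Proof.
move=> mn; rewrite !PE /partial_sum coordinates_finite.
rewrite -(subnKC mn) big_split_ord /=.
rewrite [X in _ + X]big1 ?addr0; last first.
  by move=> i _; rewrite ltnNge leq_addr scale0r.
by apply: eq_bigr => i _; rewrite ltn_ord.
Qed.

Lemma partial_sum_norm n x : `|P n x| <= `|x|.
Proof. by rewrite (le_trans (le_bop _ _))// ler_piMl. Qed.

(** If [e i] were zero, the indicator of [i] would be a second expansion of [0]. *)
Lemma basis_neq0 i : e i != 0.
Proof.
apply/eqP => ei0; pose a j : K := (j == i)%:R.
have a0 : \sum_(j < i.+1) a j *: e j = 0.
  rewrite big1// => j _; rewrite /a; case: eqP => [->|_].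
    by rewrite ei0 scaler0.
  by rewrite scale0r.
have := coordinates_finite i.+1 a; rewrite a0.
have := coordinates_finite 0 (fun=> 0); rewrite big_ord0 => ->.
move=> /(congr1 (@^~ i)); rewrite /= ltnSn /a eqxx => /eqP.
by rewrite eq_sym oner_eq0.
Qed.

Lemma dual_partial_sum_norm n (f : dual_space X) :
  `|bop_comp f (P n) : dual_space X| <= `|f|.
Proof. by apply: le_trans (bop_comp_norm f (P n)) _; rewrite ler_piMr. Qed.

(* If [phi] kills every [f \o P n] then
   [f (P n x) = (bidual_embedding x + c *: phi) (f \o P n)], so that
   [bidual_embedding x + c *: phi |-> f x] has norm at most that of [f]. Its
   Hahn-Banach extension is then [bidual_embedding f], whence [phi f = 0]. *)
Lemma weakly_shrinking (f : dual_space X) (phi : dual_space (dual_space X)) :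
  m_embedded X -> (forall n, phi (bop_comp f (P n)) = 0) -> phi f = 0.
Proof.
move=> Xm phi0.
pose G := [set (bidual_embedding y.1 + y.2 *: phi, f y.1) | y in [set: X * K]].
have embP a u v : bidual_embedding (a *: u + v) =
    a *: bidual_embedding u + bidual_embedding v.
  by apply: bop_ext => g; exact: linearP.
have emb0 : bidual_embedding (0 : X) = 0.
  by apply: bop_ext => g; exact: linear0.
have [||psi psif psiG] :=
  @norm_hahn_banach R k (dual_space (dual_space X)) `|f| G.
- by [].
- split.
  + exists (0, 0) => //=; rewrite emb0 scale0r addr0; congr pair.
    exact: linear0.
  + move=> a _ _ [[u s] _ <-] [[v t] _ <-].
    exists (a *: u + v, a * s + t) => //=.
    have -> : bidual_embedding (a *: u + v) + (a * s + t) *: phi =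
        a *: (bidual_embedding u + s *: phi) + (bidual_embedding v + t *: phi).
      by rewrite embP scalerDr scalerA scalerDl addrACA.
    by rewrite linearP.
  + move=> _ [[x c] _ <-] /=.
    set g := bidual_embedding x + c *: phi.
    have fP n : `|f (P n x)| <= `|g| * `|f|.
      have -> : f (P n x) = g (bop_comp f (P n)).
        change (f (P n x) = f (P n x) + c * phi (bop_comp f (P n))).
        by rewrite phi0 mulr0 addr0.
      apply: le_trans (le_opnorm g _) _.
      by apply: ler_wpM2l; [exact: opnorm_ge0|exact: dual_partial_sum_norm].
    (* The bound [fP] is uniform in [n], so it passes to the limit [f x]. *)
    have fPx : f (P n x) @[n --> \oo] --> f x.
      by apply: continuous_cvg; [exact: bop_continuous|exact: partial_sum_cvg].
    rewrite mulrC; apply/ler_addgt0Pr => d d0.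
    move/cvgrPdist_lt : fPx => /(_ d d0)[N _ /(_ N (leqnn N))] /= /ltW fd.
    rewrite -[f x](subrK (f (P N x))) addrC (le_trans (ler_normD _ _))//.
    by rewrite lerD.
have psiE x : psi (bidual_embedding x) = f x.
  by apply: psiG; exists (x, 0) => //=; rewrite scale0r addr0.
have := m_embedded_extension Xm psif psiE => psi_f.
have -> : phi f = psi phi by rewrite psi_f.
apply: psiG; exists (0, 1) => //=; rewrite emb0 scale1r add0r.
by congr pair; exact: linear0.
Qed.

Lemma shrinking (f : dual_space X) (d : K) : m_embedded X -> 0 < d ->
  exists N, forall n, (N <= n)%N -> `|f - bop_comp f (P n)| <= d.
Proof.
move=> Xm d0.
pose M := [set g : dual_space X | exists n, bop_comp g (P n) = g].
have [[g Mg fg]|nM] := pselect (exists2 g, M g & `|f - g| <= d / 2).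
  case: Mg => N gN; exists N => n Nn.
  have gn : bop_comp g (P n) = g.
    apply: bop_ext => x; rewrite -[in LHS]gN -[in RHS]gN /=.
    by rewrite partial_sumM.
  (* Since [g] is fixed by [P n], it cancels, leaving two terms of norm at most [d / 2]. *)
  have -> : f - bop_comp f (P n) = (f - g) - bop_comp (f - g) (P n).
    apply: bop_ext => x.
    change (f x - f (P n x) = f x - g x - (f (P n x) - g (P n x))).
    by rewrite -[in RHS]gn /= partial_sumM// opprB addrA subrK.
  rewrite (le_trans (ler_normB _ _))// [leRHS]splitr lerD//.
  by rewrite (le_trans (dual_partial_sum_norm n (f - g))).
(* Otherwise [f] stays at distance at least [d / 2] from [M]. A functional killing [M] kills every
   [f \o P n], yet [phi f = 1]. *)
have [||||phi [phif phiM]] :=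
  @separating_functional R k (dual_space X) M f (d / 2).
- by exists 0; apply: bop_ext.
- move=> a u v [m um] [n vn]; exists (maxn m n); apply: bop_ext => x.
  change (a *: u (P (maxn m n) x) + v (P (maxn m n) x) = a *: u x + v x).
  congr (_ *: _ + _).
    by rewrite -um /= partial_sumM// leq_maxl.
  by rewrite -vn /= partial_sumM// leq_maxr.
- by rewrite divr_gt0.
- move=> g Mg; rewrite real_leNgt ?normr_real// ?gtr0_real ?divr_gt0//.
  by apply/negP => /ltW fg; apply: nM; exists g.
have phif0 : phi f = 0.
  apply: weakly_shrinking => // n; apply: phiM; exists n.
  by apply: bop_ext => x /=; rewrite partial_sumM.
by move/eqP: phif; rewrite phif0 eq_sym oner_eq0.
Qed.

End monotone_basis.

(** * Compact sets of scalars and closed norm conditions *)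

Section compactness.
Variable R : realType.

(** The compact set is the square around the disc, a continuous image of a product of two
    segments. *)
Lemma compact_disc_complex (r : R) : exists2 D : set R[i]^o, compact D &
  forall a : R[i], `|a| <= (r%:C)%C -> D a.
Proof.
pose h (x : R * R) : R[i]^o := (x.1 +i* x.2)%C.
exists (h @` (`[- r, r] `*` `[- r, r])); last first.
  move=> [a b] abr; exists (a, b) => //=.
  rewrite /= !in_itv /= -!ler_norml -!lecR; split.
    exact: le_trans (normc_ge_Re (a +i* b)%C) abr.
  rewrite (le_trans _ abr)// normc_def lecR -sqrtr_sqr ler_wsqrtr//.
  by rewrite lerDr sqr_ge0.
apply: continuous_compact; last first.
  by apply: compact_setX; exact: segment_compact.
apply: continuous_subspaceT => x; apply/cvgrPdist_lt => e e0.
(* A positive complex number is real; half of it is allotted to each of the two coordinates. *)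
have [d d0 ed] : exists2 d : R, 0 < d & e = ((d *+ 2)%:C)%C.
  exists (complex.Re e / 2).
    by move: e0; rewrite ltcE /= => /andP[_ e0]; rewrite divr_gt0.
  by rewrite -[_ *+ 2]mulr_natr divfK// RRe_real ?gtr0_real//.
have hle (u : R * R) : `|h u| <= ((`|u.1| + `|u.2|)%:C)%C.
  rewrite normc_def lecR -[leRHS]ger0_norm ?addr_ge0// -sqrtr_sqr ler_wsqrtr//=.
  rewrite sqrrD !real_normK ?num_real// -addrA lerD2l addrC lerDl.
  by rewrite mulrn_wge0// mulr_ge0.
near=> y.
have -> : h x - h y = h (x - y) by [].
rewrite (le_lt_trans (hle _))// ed ltcR mulr2n.
apply: ltrD; near: y.
  by apply: cvgr_dist_lt => //; exact: cvg_fst.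
by apply: cvgr_dist_lt => //; exact: cvg_snd.
Unshelve. all: by end_near. Qed.

Variable k : scalar_kind.
Local Notation K := (scalar_field R k).

Lemma compact_disc (r : K) : 0 <= r -> exists2 D : set K^o, compact D &
  forall a, `|a| <= r -> D a.
Proof.
case: k r => /= r r0.
  exists [set` `[- r, r]]; first exact: segment_compact.
  by move=> a; rewrite ler_norml => ar; rewrite /= in_itv.
have [D cD DP] := compact_disc_complex (complex.Re r); exists D => // a ar.
by apply: DP; rewrite RRe_real// ger0_real.
Qed.

Lemma of_real_dist_lt (x y e : R) :
  (`|of_real x - of_real y| < of_real e :> K) = (`|x - y| < e).
Proof.
case: k => //=.
by rewrite -rmorphB normc_def /= expr0n addr0 sqrtr_sqr ltcR.
Qed.

Lemma real_part_norm_continuous (V : normedModType K) :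
  continuous (fun v : V => real_part `|v| : R).
Proof.
move=> v; apply/cvgrPdist_lt => e e0; near=> w.
have E (u : V) : of_real (real_part `|u|) = `|u| :> K by exact: real_partK.
have : `| `|v| - `|w| | < of_real e :> K.
  apply: le_lt_trans (ler_dist_dist v w) _; near: w.
  apply: cvgr_dist_lt; first exact: cvg_id.
  rewrite lt_neqAle -of_real0 ler_of_real ltW// andbT.
  by apply/eqP => /(can_inj of_realK) /eqP; rewrite lt_eqF.
by rewrite -of_real_dist_lt !E.
Unshelve. all: by end_near. Qed.

(** The norm is [K]-valued; passing to its real part makes the set the preimage of a closed
    half-line of [R]. *)
Lemma closed_norm_le (V W : normedModType K) (f : V -> W) (r : R) :
  continuous f -> closed [set v | `|f v| <= of_real r].
Proof.
move=> cf; have -> : [set v | `|f v| <= of_real r] =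
    (fun v => real_part `|f v| : R) @^-1` [set x | x <= r].
  apply/seteqP.
  by split=> v /=; rewrite -[`|f v|]real_partK// ler_of_real of_realK.
apply: preimage_closed; last exact: closed_le.
move=> v _; apply: (@continuous_comp _ _ _ f (fun w => real_part `|w|)).
  exact: cf.
exact: real_part_norm_continuous.
Qed.

End compactness.

(** * Norm attainment and approximation of compact operators *)

Section compact_approximation.
Variables (R : realType) (k : scalar_kind).
Local Notation K := (scalar_field R k).
Variables (X : normedModType K) (e : nat -> X) (P : nat -> bop X X).
Hypothesis basis_e : schauder_basis e.
Hypothesis PE : forall n, P n =1 partial_sum e n.
Hypothesis P1 : forall n, `|P n| <= 1.

(** The [i]-th term of the expansion is a difference of two consecutive partial sums, each of norm
    at most 1. *)
Lemma coordinate_bound i x : `|x| <= 1 -> `|coordinates e x i| <= 2 / `|e i|.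
Proof.
move=> x1; have ei0 : 0 < `|e i| by rewrite normr_gt0 (basis_neq0 basis_e).
rewrite ler_pdivlMr// -normrZ.
have -> : coordinates e x i *: e i = P i.+1 x - P i x.
  by rewrite !PE /partial_sum big_ord_recr /= addrAC subrr add0r.
rewrite (le_trans (ler_normB _ _))// [leRHS](_ : 2 = 1 + 1)//.
by rewrite lerD// (le_trans (partial_sum_norm P1 _ _)).
Qed.

(** Each induction step adds to [C] the multiples of [e n] by a compact set of scalars containing
    all [n]-th coordinates of the ball. *)
Lemma partial_sum_ball_compact n : exists2 C : set X, compact C &
  forall x, `|x| <= 1 -> C (P n x).
Proof.
elim: n => [|n [C cC CP]].
  exists [set 0]; first exact: compact_set1.
  by move=> x _ /=; rewrite PE /partial_sum big_ord0.
have [|D cD DP] := @compact_disc R k (2 / `|e n|); first by rewrite divr_ge0.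
exists ((fun u : X * K^o => u.1 + u.2 *: e n) @` (C `*` D)); last first.
  move=> x x1; exists (P n x, coordinates e x n).
    by split=> /=; [exact: CP|apply/DP/coordinate_bound].
  by rewrite /= !PE /partial_sum big_ord_recr.
apply: continuous_compact; last exact: compact_setX.
apply: continuous_subspaceT => u; apply: cvgD; first exact: cvg_fst.
by apply: cvgZr_tmp; exact: cvg_snd.
Qed.

Lemma partial_sum_norm_attaining (Z : normedModType K) (T : bop X Z) n :
  norm_attaining X Z (bop_comp T (P n)).
Proof.
set S := bop_comp T (P n).
have [C cC CP] := partial_sum_ball_compact n.
(* [D] is exactly the image of the closed unit ball under [P n]; being fixed by [P n] is phrased as
   a norm bound to fit [closed_norm_le]. *)
pose D := C `&` ([set u | `|u| <= 1] `&` [set u | `|P n u - u| <= 0]).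
have cD : compact D.
  rewrite /D -(@of_real0 R k) -(_ : of_real 1 = 1 :> K); last by case: (k).
  apply: compact_closedI => //; apply: closedI; apply: closed_norm_le => //.
    by move=> u; exact: cvg_id.
  move=> u; apply: cvgB; [exact: bop_continuous|exact: cvg_id].
have DP x : `|x| <= 1 -> D (P n x).
  move=> x1; split; first exact: CP.
  split; first by rewrite /= (le_trans (partial_sum_norm P1 _ _)).
  by rewrite /= (partial_sumMr basis_e PE)// subrr normr0.
have D0 : D !=set0 by exists (P n 0); apply: DP; rewrite normr0.
have [u uD umax] : exists2 u, u \in D &
    forall v, v \in D -> real_part `|T v| <= real_part `|T u| :> R.
  apply: (@compact_EVT_max _ R (fun v => real_part `|T v|)) => //.
  apply: continuous_subspaceT => v.
  apply: (@continuous_comp _ _ _ T (fun w => real_part `|w|)).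
    exact: bop_continuous.
  exact: real_part_norm_continuous.
have {uD} [_ [/= u1 Pu]] := set_mem uD.
have {}Pu : P n u = u by apply/eqP; rewrite -subr_eq0 -normr_le0.
have Su : S u = T u by rewrite /= Pu.
have normS : `|S| = `|S u|.
  apply/eqP; rewrite eq_le; apply/andP; split.
    rewrite Su -[leRHS]real_partK// ler_of_real; apply: ge_sup.
      exact: (opnorm_has_sup S).1.
    by move=> _ [x /= x1 <-]; apply: umax; rewrite inE; exact: DP.
  by rewrite (le_trans (le_bop S u))// ler_piMr.
(* The zero operator attains its norm at any unit vector; the maximizer [u] could be [0] here. *)
have [S0|S0] := eqVneq `|S| 0.
  exists (`|e 0|^-1 *: e 0); first by rewrite normfZV// (basis_neq0 basis_e).
  apply/eqP; rewrite eq_sym S0 -normr_le0 normr_id.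
  by rewrite (le_trans (le_bop S _))// S0 mul0r.
exists u => //; apply/eqP; rewrite eq_le u1 /=.
(* The norm of [S u] is that of [S], hence at most that of [S] times that of [u], which forces [u]
   to have norm at least 1. *)
have Sgt0 : 0 < `|S| by rewrite lt_def S0 /=.
by have := le_bop S u; rewrite -normS ler_pMr.
Qed.

Lemma bop_comp_compact (Z : normedModType K) (T : bop X Z) n :
  compact_operators X Z T -> compact_operators X Z (bop_comp T (P n)).
Proof.
apply: precompact_subset => _ [x /= x1 <-]; exists (P n x) => //=.
by rewrite (le_trans (partial_sum_norm P1 _ _)).
Qed.

(** If the approximation fails, the vectors [T (x n - P n (x n))] stay away from 0 for suitable
    [x n] in the ball. By compactness their halves cluster at some nonzero [y]; a functional [F]
    with [F y = 1] then contradicts the shrinking property of [F \o T]. *)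
Lemma compact_approximation (Z : normedModType K) (T : bop X Z) (d : K) :
  m_embedded X -> compact_operators X Z T -> 0 < d ->
  exists n, `|T - bop_comp T (P n)| <= d.
Proof.
move=> Xm cT d0; apply: contrapT => /forallNP nT.
have /choice[x xP] n : exists x, `|x| <= 1 /\ d <= `|T (x - P n x)|.
  apply: contrapT => /forallNP nx; apply: (nT n).
  rewrite -[leRHS]real_partK ?(ltW d0)// ler_of_real; apply: ge_sup.
    exact: (opnorm_has_sup _).1.
  move=> _ [x /= x1 <-]; apply: ler_real_part.
  have : ~~ (d <= `|T (x - P n x)|) by apply/negP => dx; apply: (nx x).
  rewrite -real_ltNge ?normr_real ?gtr0_real// => /ltW.
  by rewrite linearB.
(* The factor one half brings the differences, of norm at most 2, back into the unit ball, where
   compactness of [T] applies. *)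
pose u n := 2^-1 *: (x n - P n (x n)).
have u1 n : `|u n| <= 1.
  have [xn1 _] := xP n.
  rewrite normrZ ger0_norm ?invr_ge0// ler_pdivrMl// mulr1.
  rewrite (le_trans (ler_normB _ _))// [leRHS](_ : 2 = 1 + 1)//.
  by rewrite lerD// (le_trans (partial_sum_norm P1 _ _)).
have Tu n : d / 2 <= `|T (u n)|.
  have [_ dT] := xP n.
  by rewrite linearZ normrZ ger0_norm ?invr_ge0// mulrC ler_pM2l ?invr_gt0.
move: cT; rewrite /compact_operators /= precompactE => cT.
have [|y [_ Fy]] := cT (T (u n) @[n --> \oo]).
  by exists 0 => // n _; apply: subset_closure; exists (u n) => //=.
have d20 : 0 < d / 2 by rewrite divr_gt0.
have y0 : y != 0.
  apply/eqP => y0; move: Fy; rewrite y0.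
  move=> /(_ [set w | d / 2 <= `|w|] (ball 0 (d / 2))) [].
  - by exists 0 => // n _ /=; exact: Tu.
  - exact: nbhsx_ballx.
  - move=> w [/= dw]; rewrite -ball_normE /= sub0r normrN => wd.
    by have := le_lt_trans dw wd; rewrite ltxx.
have [F Fy1] := dual_separates y0.
have [N NP] := shrinking basis_e PE P1 (bop_comp F T) Xm (@ltr01 K).
have h0 : 0 < 2^-1 :> K by rewrite invr_gt0.
(* Shrinking with tolerance 1 bounds [F (T (u n))] by one half for large [n], while near [y] the
   values of [F] are strictly within one half of 1. *)
have [||w [/= Fw1 Fw2]] :=
  Fy [set w | `|F w| <= 2^-1] (F @^-1` ball (1 : K^o) 2^-1).
- exists N => // n Nn /=; rewrite linearZ linearZ normrZ (ger0_norm (ltW h0)).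
  rewrite ler_piMr ?(ltW h0)// linearB linearB.
  have [xn1 _] := xP n.
  apply: le_trans (NP n Nn).
  pose D := bop_comp F T - bop_comp (bop_comp F T) (P n).
  apply: le_trans (le_opnorm D (x n)) _.
  exact: ler_piMr (opnorm_ge0 _) xn1.
- by apply: bop_continuous; rewrite /= Fy1; exact: nbhsx_ballx.
move: Fw2; rewrite -ball_normE /= => Fw2.
have h2 : 2^-1 + 2^-1 = 1 :> K by rewrite -[2^-1]div1r -splitr.
have := ltr_leD Fw2 Fw1; rewrite h2 => {}Fw2.
have := le_lt_trans (ler_normD (1 - F w) (F w)) Fw2.
by rewrite subrK normr1 ltxx.
Qed.

End compact_approximation.

(** * Density of the norm-attaining compact operators *)

Theorem corollary3p12 (R : realType) (k : scalar_kind)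
    (X : completeNormedModType (scalar_field R k)) :
  m_embedded X ->
  (exists e : nat -> X, monotone_basis e) ->
  property_Ak X.
Proof.
move=> Xm [e [basis_e PP]] Z T cT.
have /choice[P Pn] n : exists P : bop X X, P =1 partial_sum e n /\ `|P| <= 1.
  by have [P] := PP n; exists P.
have PE n := (Pn n).1; have P1 n := (Pn n).2.
move=> B /nbhs_ballP[d /= d0 dB].
(* The approximation bound is not strict, whereas the ball of radius [d] is open; hence [d / 2]. *)
have d20 : 0 < d / 2 by rewrite divr_gt0.
have [n Tn] := compact_approximation basis_e PE P1 Xm cT d20.
exists (bop_comp T (P n)); split.
  split; first exact: bop_comp_compact.
  exact: (partial_sum_norm_attaining basis_e).
apply: dB; rewrite -ball_normE /=; apply: le_lt_trans Tn _.
by rewrite gtr_pMr// invf_lt1// ltr1n.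
Qed.
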